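(* Let $\mathcal T$ be a theory over a binary signature (every relation symbol has arity at most $2$). If $\mathcal T$ has the Bounded Derivation Depth property (BDD), then $\mathcal T$ is finitely controllable (FC).
   Context: A (single-head) existential TGD is a formula $\forall \bar x\,(\Phi(\bar x)\Rightarrow \exists y\, Q(y,\bar y))$, where $\Phi$ is a conjunction of atoms, $Q$ is a relation symbol and $\bar y\subseteq \bar x$. A plain datalog rule is a formula $\forall\bar x\,(\Phi(\bar x)\Rightarrow Q(\bar y))$ with $\Phi$ a conjunction of atoms and $\bar y\subseteq\bar x$. A theory is a finite set of existential TGDs and plain datalog rules. A database instance is a finite set of ground atoms. Queries are Boolean conjunctive queries (existentially quantified conjunctions of atoms, no negation). For a theory $\mathcal T$, an instance $D$ and a query $\Phi$, write $\mathcal T,D\models\Phi$ if every (possibly infinite) structure satisfying all atoms of $D$ and all rules of $\mathcal T$ satisfies $\Phi$. $\mathcal T$ is BDD if for every conjunctive query $\Phi$ there is a finite union of conjunctive queries $\Phi'$ such that for every database instance $D$: $\mathcal T,D\models\Phi$ iff $D\models\Phi'$. $\mathcal T$ is FC if for every database instance $D$ and every query $\Phi$ with $\mathcal T,D\not\models\Phi$ there is a finite structure $\mathcal M$ satisfying all atoms of $D$ and all rules of $\mathcal T$ with $\mathcal M\not\models\Phi$. *)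

(* Defs.v *)
From Stdlib Require Import List Arith.
Import ListNotations.
Set Implicit Arguments.

Definition var := nat.
Definition const := nat.

(* An atom R(t_1,...,t_k): a relation symbol and a list of arguments.
   In rules and queries the arguments are variables; in database instances
   they are constants. *)
Record atom (Sig : Type) := mkAtom { a_rel : Sig; a_args : list nat }.
Arguments mkAtom {Sig}.

(* TGD body Q ys   :  forall xs, /\ body -> exists y, Q(y, ys)
   Datalog body Q ys :  forall xs, /\ body -> Q(ys)                       *)
Inductive rule (Sig : Type) :=
| TGD (body : list (atom Sig)) (Q : Sig) (ys : list var)
| Datalog (body : list (atom Sig)) (Q : Sig) (ys : list var).
Arguments TGD {Sig}.
Arguments Datalog {Sig}.

Definition theory (Sig : Type) := list (rule Sig).
Definition database (Sig : Type) := list (atom Sig).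
Definition cq (Sig : Type) := list (atom Sig).       (* Boolean CQ: all vars existential *)
Definition ucq (Sig : Type) := list (cq Sig).

Definition wf_atom (Sig : Type) (ar : Sig -> nat) (a : atom Sig) : Prop :=
  length (a_args a) = ar (a_rel a).

Definition occurs_in (Sig : Type) (x : var) (body : list (atom Sig)) : Prop :=
  exists a, In a body /\ In x (a_args a).

Definition wf_rule (Sig : Type) (ar : Sig -> nat) (r : rule Sig) : Prop :=
  match r with
  | TGD body Q ys =>
      Forall (wf_atom ar) body /\ S (length ys) = ar Q /\
      (forall y, In y ys -> occurs_in y body)
  | Datalog body Q ys =>
      Forall (wf_atom ar) body /\ length ys = ar Q /\
      (forall y, In y ys -> occurs_in y body)
  end.

Definition wf_theory (Sig : Type) (ar : Sig -> nat) (T : theory Sig) : Prop :=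
  Forall (wf_rule ar) T.

Record structure (Sig : Type) := mkStructure {
  dom : Type;
  rel : Sig -> list dom -> Prop }.
Arguments mkStructure {Sig}.

Definition finite_structure (Sig : Type) (M : structure Sig) : Prop :=
  exists l : list (dom M), forall x : dom M, In x l.

Definition holds (Sig : Type) (M : structure Sig) (v : nat -> dom M) (a : atom Sig) : Prop :=
  rel M (a_rel a) (map v (a_args a)).

Definition sat_rule (Sig : Type) (M : structure Sig) (r : rule Sig) : Prop :=
  match r with
  | TGD body Q ys =>
      forall v : var -> dom M, Forall (holds M v) body ->
        exists d : dom M, rel M Q (d :: map v ys)
  | Datalog body Q ys =>
      forall v : var -> dom M, Forall (holds M v) body -> rel M Q (map v ys)
  end.

Definition models (Sig : Type) (M : structure Sig) (T : theory Sig) : Prop :=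
  Forall (sat_rule M) T.

Definition sat_db (Sig : Type) (M : structure Sig) (c : const -> dom M) (D : database Sig) : Prop :=
  Forall (holds M c) D.

Definition sat_cq (Sig : Type) (M : structure Sig) (q : cq Sig) : Prop :=
  exists v : var -> dom M, Forall (holds M v) q.

Definition sat_ucq (Sig : Type) (M : structure Sig) (Q : ucq Sig) : Prop :=
  Exists (sat_cq M) Q.

Definition db_structure (Sig : Type) (D : database Sig) : structure Sig :=
  mkStructure const (fun R l => In (mkAtom R l) D).

Definition entails (Sig : Type) (T : theory Sig) (D : database Sig) (q : cq Sig) : Prop :=
  forall (M : structure Sig) (c : const -> dom M),
    sat_db M c D -> models M T -> sat_cq M q.

Definition BDD (Sig : Type) (ar : Sig -> nat) (T : theory Sig) : Prop :=
  forall q : cq Sig, Forall (wf_atom ar) q ->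
    exists Q' : ucq Sig, Forall (Forall (wf_atom ar)) Q' /\
      forall D : database Sig, Forall (wf_atom ar) D ->
        (entails T D q <-> sat_ucq (db_structure D) Q').

Definition FC (Sig : Type) (ar : Sig -> nat) (T : theory Sig) : Prop :=
  forall (D : database Sig) (q : cq Sig),
    Forall (wf_atom ar) D -> Forall (wf_atom ar) q ->
    ~ entails T D q ->
    exists (M : structure Sig) (c : const -> dom M),
      finite_structure M /\ sat_db M c D /\ models M T /\ ~ sat_cq M q.

(* Main.v *)
From Stdlib Require Import List Arith Lia Classical ClassicalEpsilon FinFun.
From mathcomp Require classical_sets.
Require Import Defs.
Import ListNotations.
Set Implicit Arguments.

(** Let [q] be a query not entailed by [T] and [D], and let [Q'] be its
    rewriting, so that a database entails [q] iff it satisfies [Q'].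
    Hang trees below the constants of [D]: a node is a constant with a word of
    TGD heads, and a letter [R] in front of a word creates an element [y] with
    the atom [R(y, parent)] (or [R(y)]).  By Zorn's lemma there is a maximal
    prefix-closed set [U] of nodes whose structure does not satisfy [Q']; hence
    every node lacking an [R]-child has no room for one, as adding it would
    make [Q'] true.

    Next, [U] has a finite quotient that still refutes [Q']: identify nodes
    agreeing on the depth modulo [N] and, for each of their first [N]
    ancestors, on the downward tree up to depth [N].  A pattern with fewer
    than [N] variables misses a residue of the depth, so its variables have
    well-defined heights below the missing residue; replacing the ancestor at
    that height by a representative of its class lifts the pattern to [U].

    Thus the quotient, seen as a database, does not entail [q] either, and a
    model of [T] over it that refutes [q] can be pulled back to the finite
    quotient.  The pullback satisfies the TGDs: if the witness were not
    already present in the quotient, the model would contain the quotient with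
    a new child, hence satisfy [q]. *)

(** * Forests of witnesses below the constants *)

Definition node (Sig : Type) : Type := (nat * list Sig)%type.

Definition root (Sig : Type) (n : nat) : node Sig := (n, []).

Definition child (Sig : Type) (a : Sig) (x : node Sig) : node Sig :=
  (fst x, a :: snd x).

(* For arities up to 2, [firstn (ar R)] turns child and parent into the
   arguments of a unary or a binary TGD head. *)
Definition child_args (Sig A : Type) (ar : Sig -> nat) (R : Sig) (y x : A) : list A :=
  firstn (ar R) [y; x].

(** All nodes belong to the domain and [U] restricts only the atoms, so forests over different [U]
    share a carrier and the identity is a homomorphism when [U] grows. *)
Definition forest (Sig : Type) (ar : Sig -> nat) (D : database Sig)
    (U : node Sig -> Prop) : structure Sig :=
  mkStructure (node Sig) (fun R l =>
    (exists a, In (mkAtom R a) D /\ l = map (@root Sig) a) \/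
    (exists x, U (child R x) /\ l = child_args ar R (child R x) x)).

Definition tree_domain (Sig : Type) (C : list nat) (L : list Sig)
    (U : node Sig -> Prop) : Prop :=
  (forall x, U x -> In (fst x) C) /\
  (forall n, In n C -> U (root Sig n)) /\
  (forall a x, U (child a x) -> In a L /\ U x).

Definition db_consts (Sig : Type) (D : database Sig) : list nat :=
  flat_map (@a_args Sig) D.

Lemma in_db_consts (Sig : Type) (D : database Sig) R a n :
  In (mkAtom R a) D -> In n a -> In n (db_consts D).
Proof.
  intros HD Hn. apply in_flat_map. now exists (mkAtom R a).
Qed.

Lemma map_child_args (Sig A B : Type) (ar : Sig -> nat) R (g : A -> B) y x :
  map g (child_args ar R y x) = child_args ar R (g y) (g x).
Proof.
  unfold child_args. now rewrite <- firstn_map.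
Qed.

Lemma length_child_args (Sig A : Type) (ar : Sig -> nat) R (y x : A) :
  ar R <= 2 -> length (child_args ar R y x) = ar R.
Proof.
  intros H. unfold child_args. rewrite length_firstn. simpl. lia.
Qed.

Lemma in_child_args (Sig A : Type) (ar : Sig -> nat) R (y x z : A) :
  In z (child_args ar R y x) -> z = y \/ z = x.
Proof.
  intros H. assert (In z [y; x]) as [|[|[]]]; auto.
  rewrite <- (firstn_skipn (ar R) [y; x]). apply in_or_app. now left.
Qed.

(** * Homomorphisms *)

Definition hom (Sig : Type) (A B : structure Sig) (h : dom A -> dom B) : Prop :=
  forall R l, rel A R l -> rel B R (map h l).

Lemma sat_cq_hom (Sig : Type) (A B : structure Sig) (h : dom A -> dom B) q :
  hom A B h -> sat_cq A q -> sat_cq B q.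
Proof.
  intros Hh [v Hv]. exists (fun x => h (v x)).
  revert Hv. apply Forall_impl. intros [R l] H. unfold holds in *. simpl in *.
  rewrite <- (map_map v h). now apply Hh.
Qed.

Lemma sat_ucq_hom (Sig : Type) (A B : structure Sig) (h : dom A -> dom B) Q :
  hom A B h -> sat_ucq A Q -> sat_ucq B Q.
Proof.
  intros Hh. apply Exists_impl. intros q. now apply sat_cq_hom with (h := h).
Qed.

(** * Finite partitions *)

(** The values are packed as digits in mixed radix. *)
Lemma separate_functions (X : Type) (Fs : list (X -> nat)) :
  (forall F, In F Fs -> exists B, forall x, F x < B) ->
  exists (f : X -> nat) (B : nat), (forall x, f x < B) /\
    forall x y, f x = f y -> forall F, In F Fs -> F x = F y.
Proof.
  induction Fs as [|F Fs IH]; intros HB.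
  - exists (fun _ => 0), 1. split; [auto | intros ? ? ? ? []].
  - destruct IH as (f & B & Hf & Hsep). { intros G HG. apply HB. now right. }
    destruct (HB F) as (B' & HF); [now left|].
    exists (fun x => B * F x + f x), (B * B'). split.
    + intros x. specialize (Hf x). specialize (HF x). nia.
    + intros x y E.
      destruct (Nat.div_mod_unique B (F x) (F y) (f x) (f y)) as [E1 E2]; auto.
      intros G [<-|HG]; auto.
Qed.

Definition indicator (X : Type) (P : X -> Prop) (x : X) : nat :=
  if excluded_middle_informative (P x) then 1 else 0.

Lemma separate_predicates (X : Type) (Ps : list (X -> Prop)) :
  exists (f : X -> nat) (B : nat), (forall x, f x < B) /\
    forall x y, f x = f y -> forall P, In P Ps -> P x -> P y.
Proof.
  destruct (@separate_functions X (map (@indicator X) Ps)) as (f & B & Hf & Hs).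
  - intros F HF. apply in_map_iff in HF. destruct HF as (P & <- & _).
    exists 2. intros x. unfold indicator. destruct excluded_middle_informative; lia.
  - exists f, B. split; auto. intros x y E P HP Px.
    specialize (Hs x y E _ (in_map _ _ _ HP)). unfold indicator in Hs.
    destruct (excluded_middle_informative (P x)); [|contradiction].
    destruct (excluded_middle_informative (P y)); [auto|discriminate].
Qed.

Lemma finite_comprehension (X : Type) (P : X -> Prop) (l : list X) :
  exists l', forall x, In x l' <-> In x l /\ P x.
Proof.
  exists (filter (fun x => if excluded_middle_informative (P x) then true else false) l).
  intros x. rewrite filter_In.
  destruct (excluded_middle_informative (P x)); intuition congruence.
Qed.

Lemma finitely_many_words (A : Type) (L : list A) (n : nat) :
  exists W : list (list A),
    forall v, length v <= n -> Forall (fun a => In a L) v -> In v W.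
Proof.
  induction n as [|n [W HW]].
  - exists [[]]. intros [|a v] H _; simpl in *; [auto|lia].
  - exists ([] :: flat_map (fun a => map (cons a) W) L).
    intros [|a v] H Hv; [now left|right]. inversion Hv; subst.
    apply in_flat_map. exists a. split; auto. apply in_map, HW; auto.
    simpl in H; lia.
Qed.

Lemma exists_missing_residue (N : nat) (s : list nat) :
  length s < N -> exists r, r < N /\ ~ In r s.
Proof.
  intros H. apply NNPP. intros Hn.
  assert (incl (seq 0 N) s) as Hi.
  { intros r Hr. apply in_seq in Hr. apply NNPP. intros Hs. apply Hn.
    exists r. split; [lia|auto]. }
  apply (NoDup_incl_length (seq_NoDup N 0)) in Hi. rewrite length_seq in Hi. lia.
Qed.

(** * Folding a forest *)

Section Folding.

Context (Sig : Type) (C : list nat) (L : list Sig) (U : node Sig -> Prop)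
  (HU : tree_domain C L U).

Definition ancestor (h : nat) (x : node Sig) : node Sig := (fst x, skipn h (snd x)).

Definition graft (v : list Sig) (x : node Sig) : node Sig := (fst x, v ++ snd x).

Lemma graft_ancestor h x : graft (firstn h (snd x)) (ancestor h x) = x.
Proof.
  destruct x as [d w]. unfold graft, ancestor. simpl. now rewrite firstn_skipn.
Qed.

Lemma ancestor_in h x : U x -> U (ancestor h x).
Proof.
  destruct x as [d w]. unfold ancestor. simpl. revert h.
  induction w as [|a w IH]; intros [|h] Hx; simpl; auto.
  apply IH. now apply (proj2 (proj2 HU) a (d, w)).
Qed.

Lemma letters_in x : U x -> Forall (fun a => In a L) (snd x).
Proof.
  destruct x as [d w]. simpl. induction w as [|a w IH]; intros Hx; constructor.
  - now apply (proj2 (proj2 HU) a (d, w)).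
  - apply IH. now apply (proj2 (proj2 HU) a (d, w)).
Qed.

(** Finitely many predicates suffice, since [C], [L] and the words over [L] of length at most [N]
    are finite. Isolating the roots lets lifts fix the constants. *)
Lemma downward_type (N : nat) :
  exists (f : node Sig -> nat) (B : nat), (forall x, f x < B) /\
    forall x y, U x -> f x = f y ->
      hd_error (snd x) = hd_error (snd y) /\
      (snd x = [] -> y = x) /\
      (forall v, length v <= N -> U (graft v x) -> U (graft v y)).
Proof.
  destruct (finitely_many_words L N) as [W HW].
  destruct (separate_predicates (
    map (fun a (x : node Sig) => hd_error (snd x) = Some a) L ++
    map (fun n (x : node Sig) => x = root Sig n) C ++
    map (fun v (x : node Sig) => U (graft v x)) W)) as (f & B & Hf & Hs).
  exists f, B. split; auto. intros x y Hx E.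
  assert (snd x = [] -> y = x) as Hroot.
  { intros Hw. destruct x as [d w]. simpl in Hw. subst w.
    apply (Hs _ _ E (fun z => z = root Sig d)); auto.
    apply in_or_app; right; apply in_or_app; left.
    apply (in_map (fun n (z : node Sig) => z = root Sig n)).
    now apply (proj1 HU) in Hx. }
  split; [|split]; auto.
  - destruct x as [d [|a w]].
    + now rewrite Hroot.
    + symmetry. apply (Hs _ _ E (fun z => hd_error (snd z) = Some a)); auto.
      apply in_or_app; left.
      apply (in_map (fun a (z : node Sig) => hd_error (snd z) = Some a)).
      now apply (proj2 (proj2 HU) a (d, w)).
  - intros v Hv Hg. apply (Hs _ _ E (fun z => U (graft v z))); auto.
    apply in_or_app; right; apply in_or_app; right.
    apply (in_map (fun v (z : node Sig) => U (graft v z))).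
    apply HW; auto. apply letters_in in Hg. simpl in Hg.
    now apply Forall_app in Hg.
Qed.

Lemma firstn_determined (h : nat) (w w' : list Sig) :
  (forall i, i < h -> hd_error (skipn i w) = hd_error (skipn i w')) ->
  firstn h w = firstn h w'.
Proof.
  revert w w'. induction h as [|h IH]; intros w w' H; auto.
  assert (hd_error w = hd_error w') as E by (apply (H 0); lia).
  destruct w as [|a w], w' as [|b w']; simpl in E; try discriminate; auto.
  injection E as <-. simpl. f_equal. apply IH. intros i Hi. apply (H (S i)). lia.
Qed.

(* [lift h x] replaces the ancestor of [x] at height [h] by the representative
   of its class. *)
Lemma fold_forest (N : nat) :
  0 < N ->
  exists (f : node Sig -> nat) (B : nat) (lift : nat -> node Sig -> node Sig),
    (forall x, f x < B) /\
    (forall x y, U x -> U y -> f x = f y ->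
       length (snd x) mod N = length (snd y) mod N /\
       forall h, h <= N -> lift h x = lift h y) /\
    (forall h x, h <= N -> U x -> U (lift h x)) /\
    (forall h a x, lift (S h) (child a x) = child a (lift h x)) /\
    (forall h a x, U (child a x) -> exists x', lift h (child a x) = child a x') /\
    (forall h n, In n C -> lift h (root Sig n) = root Sig n).
Proof.
  intros HN.
  destruct (downward_type N) as (f0 & B0 & Hf0 & Hty).
  assert (exists rep : nat -> node Sig, forall x, U x -> U (rep (f0 x)) /\ f0 (rep (f0 x)) = f0 x)
    as [rep Hrep].
  { exists (fun i => epsilon (inhabits (root Sig 0)) (fun y => U y /\ f0 y = i)).
    intros x Hx. apply epsilon_spec. now exists x. }
  (* The final classes record the depth modulo [N] and the types of the ancestors at heights 0 to
     [N]. *)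
  destruct (@separate_functions (node Sig) (
    (fun x => length (snd x) mod N) ::
    map (fun h x => f0 (ancestor h x)) (seq 0 (S N)))) as (f & B & Hf & Hs).
  { intros F [<-|HF].
    - exists N. intros x. apply Nat.mod_upper_bound. lia.
    - apply in_map_iff in HF. destruct HF as (h & <- & _). exists B0. auto. }
  assert (forall x y h, h <= N -> f x = f y -> f0 (ancestor h x) = f0 (ancestor h y)) as Hanc.
  { intros x y h Hh E. apply (Hs _ _ E (fun x => f0 (ancestor h x))). right.
    apply (in_map (fun h (x : node Sig) => f0 (ancestor h x))). apply in_seq. lia. }
  exists f, B, (fun h x => graft (firstn h (snd x)) (rep (f0 (ancestor h x)))).
  split; [auto|]. split; [|split; [|split; [|split]]].
  - intros x y Hx Hy E. split.
    + apply (Hs _ _ E (fun x => length (snd x) mod N)). now left.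
    (* A type knows the first letter, so the types at heights below [h] determine the letters that
       are kept. *)
    + intros h Hh. rewrite (Hanc x y h Hh E). f_equal. apply firstn_determined.
      intros i Hi. destruct (Hty (ancestor i x) (ancestor i y)) as (Hhd & _).
      * now apply ancestor_in.
      * apply Hanc; auto. lia.
      * exact Hhd.
  (* At most [N] letters are grafted, and the representative admits every such graft that the
     ancestor admits. *)
  - intros h x Hh Hx.
    destruct (Hrep (ancestor h x)) as [H1 H2]; [now apply ancestor_in|].
    apply (Hty (ancestor h x)); auto.
    + now apply ancestor_in.
    + rewrite length_firstn. lia.
    + now rewrite graft_ancestor.
  - reflexivity.
  (* At height 0 the whole node is replaced, but its representative starts with the same letter. *)
  - intros [|h] a x Hx; [|now exists (graft (firstn h (snd x)) (rep (f0 (ancestor h x))))].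
    destruct (Hrep (child a x) Hx) as [H1 H2].
    destruct (Hty (child a x) (rep (f0 (child a x))) Hx) as (Hhd & _); auto.
    exists (fst (rep (f0 (child a x))), tl (snd (rep (f0 (child a x))))).
    change (ancestor 0 (child a x)) with (child a x).
    destruct (rep (f0 (child a x))) as [d [|b w]]; simpl in Hhd; [discriminate|].
    injection Hhd as <-. reflexivity.
  - intros h n Hn.
    assert (U (root Sig n)) as Hx by now apply (proj1 (proj2 HU)).
    assert (ancestor h (root Sig n) = root Sig n) as ->.
    { unfold ancestor, root. simpl. now rewrite skipn_nil. }
    destruct (Hrep _ Hx) as [H1 H2].
    destruct (Hty _ (rep (f0 (root Sig n))) Hx) as (_ & Hr & _); auto.
    rewrite Hr by auto. simpl. now rewrite firstn_nil.
Qed.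

End Folding.

(** Tree atoms relate only a child to its parent, and measuring heights from a missing residue makes
    their lifts agree; atoms of [D] lie on roots, which every lift fixes. *)
Lemma fold_conservative (Sig : Type) (ar : Sig -> nat) (D : database Sig)
    (C : list nat) (L : list Sig) (U : node Sig -> Prop) (N : nat) :
  (forall R, ar R <= 2) -> incl (db_consts D) C -> tree_domain C L U ->
  exists (f : node Sig -> nat) (B : nat), (forall x, f x < B) /\
    forall (M : database Sig) p,
      (forall R l, In (mkAtom R l) M ->
         exists l', rel (forest ar D U) R l' /\ l = map f l') ->
      length (db_consts p) < N ->
      sat_cq (db_structure M) p -> sat_cq (forest ar D U) p.
Proof.
  intros Har HD HU. destruct (Nat.eq_0_gt_0_cases N) as [->|HN].
  { exists (fun _ => 0), 1. split; [auto|]. intros; lia. }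
  destruct (fold_forest HU HN) as (f & B & lift & Hf & Hcls & HliftU & Hstep & Hhead & Hroot).
  exists f, B. split; auto. intros M p HM Hp [v Hv]. change (nat -> nat) in (type of v).
  set (rep := fun i => epsilon (inhabits (root Sig 0)) (fun y => U y /\ f y = i)).
  assert (forall x, U x -> U (rep (f x)) /\ f (rep (f x)) = f x) as Hrep.
  { intros x Hx. unfold rep. apply epsilon_spec. now exists x. }
  destruct (@exists_missing_residue N
    (map (fun y => length (snd (rep (v y))) mod N) (db_consts p))) as (r & Hr & Hmiss).
  { now rewrite length_map. }
  (* This is [m - r - 1] modulo [N]: it grows by one with the depth, except that it drops from
     [N - 1] to 0 after residue [r]. *)
  set (height := fun m => (m + (N - 1 - r)) mod N).
  assert (forall m, height m <= N) as HleN.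
  { intros m. apply Nat.lt_le_incl, Nat.mod_upper_bound. lia. }
  assert (forall m m', m mod N = m' mod N -> height m = height m') as Hmod.
  { intros m m' E. unfold height.
    now rewrite <- (Nat.Div0.add_mod_idemp_l m), <- (Nat.Div0.add_mod_idemp_l m'), E. }
  assert (forall m, m mod N <> r -> height (S m) = S (height m)) as HS.
  { intros m Hm.
    rewrite (Hmod m (m mod N)) by now rewrite Nat.Div0.mod_mod.
    rewrite (Hmod (S m) (S (m mod N))).
    2:{ rewrite <- (Nat.add_1_l m), <- (Nat.add_1_l (m mod N)).
        now rewrite Nat.Div0.add_mod_idemp_r. }
    assert (m mod N < N) as Hlt by (apply Nat.mod_upper_bound; lia).
    revert Hm Hlt. generalize (m mod N) as k. intros k Hk Hlt. unfold height.
    destruct (Nat.lt_ge_cases k r).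
    - rewrite !Nat.mod_small; lia.
    - replace (S k + (N - 1 - r)) with (k - r + 1 * N) by lia.
      replace (k + (N - 1 - r)) with (k - r - 1 + 1 * N) by lia.
      rewrite !Nat.Div0.mod_add, !Nat.mod_small; lia. }
  set (e := fun i => lift (height (length (snd (rep i)))) (rep i)).
  (* The class fixes the depth modulo [N] and all lifts, so the choice of representative does not
     matter. *)
  assert (forall x, U x -> e (f x) = lift (height (length (snd x))) x) as He.
  { intros x Hx. destruct (Hrep x Hx) as [H1 H2]. unfold e.
    destruct (Hcls (rep (f x)) x) as [H3 H4]; auto.
    rewrite (Hmod _ _ H3). apply H4, HleN. }
  exists (fun y => e (v y)). apply Forall_forall. intros [R ys] Hin.
  assert (holds (db_structure M) v (mkAtom R ys)) as Hatom.
  { rewrite Forall_forall in Hv. now apply Hv. }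
  apply HM in Hatom. destruct Hatom as (l' & Hl' & E). simpl in E.
  change (rel (forest ar D U) R (map (fun y : nat => e (v y)) ys)).
  change (map v ys = map f l') in E.
  change (rel (forest ar D U) R l') in Hl'.
  rewrite <- (map_map v e). rewrite E.
  destruct Hl' as [(a & Ha & ->)|(x & Hx & ->)].
  - left. exists a. split; auto. rewrite !map_map. apply map_ext_in. intros n Hn.
    assert (In n C) as HnC by (apply HD; eapply in_db_consts; eauto).
    rewrite He by now apply HU. auto.
  - right. rewrite !map_child_args in *.
    assert (U x) as Ux by now apply HU in Hx.
    destruct (Nat.eq_dec (ar R) 2) as [E2|E2].
    (* In a binary atom the parent is the value of a variable of the pattern, so its depth avoids
       [r]. *)
    + assert (length (snd x) mod N <> r) as Hok.
      { intros Hbad. apply Hmiss.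
        assert (In (f x) (map v ys)) as Hfx.
        { rewrite E. unfold child_args. rewrite E2. simpl. auto. }
        apply in_map_iff in Hfx. destruct Hfx as (y & Hy1 & Hy2).
        apply in_map_iff. exists y. split; [|eapply in_db_consts; eauto].
        rewrite Hy1. destruct (Hrep x Ux) as [H1 H2].
        now rewrite (proj1 (Hcls _ _ H1 Ux H2)). }
      exists (e (f x)).
      assert (e (f (child R x)) = child R (e (f x))) as <-.
      { rewrite !He by auto. simpl length. rewrite HS by auto. apply Hstep. }
      split; auto. rewrite He by auto. now apply HliftU.
    (* Here the parent is not an argument: the lifted child only has to begin with [R]. *)
    + destruct (Hhead (height (length (snd (child R x)))) R x Hx) as [x' Hx'].
      exists x'. rewrite <- Hx'. split; [now apply HliftU|].
      rewrite (He (child R x)) by auto. unfold child_args.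
      assert (ar R = 0 \/ ar R = 1) as [->| ->] by (specialize (Har R); lia); auto.
Qed.

(** * Maximal consistent forests *)


Definition refuting (Sig : Type) (ar : Sig -> nat) (D : database Sig)
    (C : list nat) (L : list Sig) (Q' : ucq Sig) (U : node Sig -> Prop) : Prop :=
  tree_domain C L U /\ ~ sat_ucq (forest ar D U) Q'.

(** The least tree domain; the atoms of its forest are a copy of [D]. *)
Definition trunk (Sig : Type) (C : list nat) (x : node Sig) : Prop :=
  exists n, In n C /\ x = root Sig n.

Lemma trunk_tree_domain (Sig : Type) (C : list nat) (L : list Sig) :
  tree_domain C L (@trunk Sig C).
Proof.
  split; [|split].
  - intros x (n & Hn & ->). exact Hn.
  - intros n Hn. now exists n.
  - intros a x (n & _ & E). discriminate E.
Qed.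

Lemma trunk_hom (Sig : Type) (ar : Sig -> nat) (D : database Sig) (C : list nat) :
  @hom Sig (forest ar D (@trunk Sig C)) (db_structure D) fst.
Proof.
  intros R l [(a & Ha & ->)|(x & (n & _ & E) & _)]; [|discriminate E].
  simpl. rewrite map_map. simpl. now rewrite map_id.
Qed.

Lemma maximal_refuting (Sig : Type) (ar : Sig -> nat) (D : database Sig)
    (C : list nat) (L : list Sig) (Q' : ucq Sig) :
  ~ sat_ucq (db_structure D) Q' ->
  exists U, refuting ar D C L Q' U /\
    forall V, (forall x, U x -> V x) -> refuting ar D C L Q' V -> forall x, V x -> U x.
Proof.
  intros HQ.
  (* Zorn's lemma also asks about the empty chain, whose union lacks the roots; [grow] puts them
     back. *)
  set (grow := fun (A : node Sig -> Prop) x => A x \/ trunk C x).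
  destruct (@classical_sets.Zorn_bigcup (node Sig)
    (fun A => refuting ar D C L Q' (grow A))) as (A & HA & Hmax).
  - intros F HF Htot.
    set (Un := grow _).
    assert (forall x, Un x <-> (exists A, F A /\ A x) \/ trunk C x) as HUn.
    { intros x. unfold Un, grow. split; (intros [H|H]; [left|now right]).
      - destruct H as [A HA Hx]. now exists A.
      - destruct H as (A & HA & Hx). now exists A. }
    destruct (trunk_tree_domain C L) as (T1 & T2 & T3).
    split.
    + split; [|split].
      * intros x Hx. apply HUn in Hx. destruct Hx as [(A & HA & Hx)|Hx]; auto.
        apply (HF A HA). now left.
      * intros n Hn. apply HUn. right. auto.
      * intros a x Hx. apply HUn in Hx. destruct Hx as [(A & HA & Hx)|Hx].
        -- destruct (HF A HA) as ((_ & _ & H3) & _).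
           destruct (H3 a x) as (Ha & Hx'); [now left|]. split; auto.
           apply HUn. destruct Hx'; [left; now exists A | now right].
        -- destruct (T3 a x Hx). split; auto. apply HUn. now right.
    + intros HS. apply Exists_exists in HS. destruct HS as (p & Hp & v & Hv).
      (* finitely many atoms only use one member of the chain *)
      assert ((exists A, F A /\ Forall (holds (forest ar D (grow A)) v) p) \/
              Forall (holds (forest ar D (trunk C)) v) p) as HH.
      { clear Hp. induction Hv as [|a p Ha Hv IH]; [right; constructor|].
        assert ((exists A, F A /\ holds (forest ar D (grow A)) v a) \/
                holds (forest ar D (trunk C)) v a) as Ha'.
        { destruct Ha as [Ha|(x & Hx & E)]; [right; now left|].
          apply HUn in Hx. destruct Hx as [(A & HA & Hx)|Hx].
          - left. exists A. split; auto. right. exists x. split; auto. now left.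
          - right. right. now exists x. }
        assert (forall (V W : node Sig -> Prop) b, (forall x, V x -> W x) ->
          holds (forest ar D V) v b -> holds (forest ar D W) v b) as Hmono.
        { intros V W b HVW [Hb|(x & Hx & E)]; [now left|].
          right. exists x. auto. }
        destruct Ha' as [(A & HA & Ha')|Ha'], IH as [(A' & HA' & IH)|IH].
        - left. destruct (Htot A A' HA HA') as [Hs|Hs].
          + exists A'. split; auto. constructor; auto.
            revert Ha'. apply Hmono. intros x [Hx|Hx]; [left; now apply Hs|now right].
          + exists A. split; auto. constructor; auto.
            revert IH. apply Forall_impl. intros b. apply Hmono.
            intros x [Hx|Hx]; [left; now apply Hs|now right].
        - left. exists A. split; auto. constructor; auto.
          revert IH. apply Forall_impl. intros b. apply Hmono. now right.
        - left. exists A'. split; auto. constructor; auto.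
          revert Ha'. apply Hmono. now right.
        - right. now constructor. }
      destruct HH as [(A & HA & HH)|HH].
      * apply (HF A HA). apply Exists_exists. exists p. split; auto. now exists v.
      * apply HQ. apply (sat_ucq_hom (@trunk_hom _ ar D C)).
        apply Exists_exists. exists p. split; auto. now exists v.
  - exists (grow A). split; auto. intros V HV HVr x Vx. apply NNPP. intros Hx.
    apply (Hmax V).
    + split.
      * intros y Hy. apply HV. now left.
      * intros Hs. apply Hx. left. now apply Hs.
    (* [V] already contains the trunk. The two predicates are only equivalent, hence the transfer
       along the identity homomorphism below. *)
    + assert (forall y, grow V y <-> V y) as Hg.
      { intros y. split; [intros [Hy|Hy]|intros Hy; now left]; auto.
        apply HV. now right. }
      destruct HVr as ((H1 & H2 & H3) & H4). split.
      * split; [|split].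
        -- intros y Hy. apply H1. now apply Hg.
        -- intros n Hn. left. auto.
        -- intros a y Hy. apply Hg, H3 in Hy. destruct Hy. split; auto. now left.
      * intros HS. apply H4.
        refine (@sat_ucq_hom _ (forest ar D (grow V)) (forest ar D V) (fun y => y) _ _ HS).
        intros R l. rewrite map_id. intros [Hb|(y & Hy & E)]; [now left|].
        right. exists y. split; auto. now apply Hg.
Qed.

(** Adding a child of a member keeps a tree domain, so only the query can block the extension. *)
Lemma maximal_refuting_child (Sig : Type) (ar : Sig -> nat) (D : database Sig)
    (C : list nat) (L : list Sig) (Q' : ucq Sig) (U : node Sig -> Prop) :
  refuting ar D C L Q' U ->
  (forall V, (forall x, U x -> V x) -> refuting ar D C L Q' V -> forall x, V x -> U x) ->
  forall a x, In a L -> U x -> ~ U (child a x) ->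
    sat_ucq (forest ar D (fun y => U y \/ y = child a x)) Q'.
Proof.
  intros ((H1 & H2 & H3) & _) Hmax a x Ha Hx Hn. apply NNPP. intros HQ. apply Hn.
  apply (Hmax (fun y => U y \/ y = child a x)); auto. split; auto.
  split; [|split]; auto.
  - intros y [Hy| ->]; auto. now apply (H1 x).
  - intros b [d w] [Hy|E].
    + destruct (H3 b _ Hy). auto.
    + destruct x as [d' w']. injection E as -> -> ->. auto.
Qed.

(** * Finite controllability *)

(** Even for infinite [U], tree atoms have labels in [L] and arguments below [B] after folding. *)
Lemma finite_forest_image (Sig : Type) (ar : Sig -> nat) (D : database Sig)
    (C : list nat) (L : list Sig) (U : node Sig -> Prop) (f : node Sig -> nat) (B : nat) :
  tree_domain C L U -> (forall x, f x < B) ->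
  exists M : database Sig, forall R l, In (mkAtom R l) M <->
    exists l', rel (forest ar D U) R l' /\ l = map f l'.
Proof.
  intros HU Hf.
  set (all := flat_map (fun R => flat_map (fun i => map (fun j =>
    mkAtom R (child_args ar R i j)) (seq 0 B)) (seq 0 B)) L).
  destruct (@finite_comprehension (atom Sig) (fun a => exists l',
    rel (forest ar D U) (a_rel a) l' /\ a_args a = map f l')
    (map (fun a => mkAtom (a_rel a) (map (fun n => f (root Sig n)) (a_args a))) D ++ all))
    as (M & HM).
  exists M. intros R l. rewrite HM. split; [now intros [_ H]|].
  intros (l' & Hl' & ->). split; [|now exists l'].
  apply in_or_app. destruct Hl' as [(a & Ha & ->)|(x & Hx & ->)].
  - left. apply in_map_iff. exists (mkAtom R a). split; auto. simpl. now rewrite map_map.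
  - right. rewrite map_child_args. apply in_flat_map. exists R.
    split; [now apply HU in Hx|].
    apply in_flat_map. exists (f (child R x)). split.
    { apply in_seq. specialize (Hf (child R x)). lia. }
    apply (in_map (fun j => mkAtom R (child_args ar R (f (child R x)) j))).
    apply in_seq. specialize (Hf x). lia.
Qed.

Definition tgd_heads (Sig : Type) (T : theory Sig) : list Sig :=
  flat_map (fun r => match r with TGD _ Q _ => [Q] | Datalog _ _ _ => [] end) T.

Theorem theorem2 (Sig : Type) (ar : Sig -> nat) (T : theory Sig) :
  (forall R : Sig, ar R <= 2) ->
  wf_theory ar T ->
  BDD ar T -> FC ar T.
Proof.
  intros Har HT HBDD D q HD Hq Hent.
  destruct (HBDD q Hq) as (Q' & _ & HQ').
  (* The extra 0 guarantees a root even when [D] has no constants. *)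
  set (C := 0 :: db_consts D). set (L := tgd_heads T).
  destruct (@maximal_refuting _ ar D C L Q') as (U & HU & Hmax).
  { now rewrite <- HQ'. }
  pose proof (maximal_refuting_child HU Hmax) as Hfull. destruct HU as [HU HUQ].
  (* [N] exceeds the number of variable occurrences in every disjunct of [Q']. *)
  set (N := S (list_max (map (fun p => length (db_consts p)) Q'))).
  destruct (@fold_conservative _ ar D C L U N Har) as (f & B & Hf & Hcons); auto.
  { intros n Hn. now right. }
  destruct (finite_forest_image ar D f HU Hf) as (M & HM).
  assert (Forall (wf_atom ar) M) as HMwf.
  { apply Forall_forall. intros [R l] Hl. apply HM in Hl.
    destruct Hl as (l' & Hl' & ->). unfold wf_atom. simpl. rewrite length_map.
    destruct Hl' as [(a & Ha & ->)|(x & Hx & ->)].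
    - rewrite length_map. rewrite Forall_forall in HD. now apply HD in Ha.
    - now apply length_child_args. }
  assert (~ entails T M q) as HMent.
  { rewrite HQ' by exact HMwf. intros HS. apply HUQ.
    apply Exists_exists in HS. destruct HS as (p & Hp & HS).
    apply Exists_exists. exists p. split; auto. apply Hcons with M; auto.
    - intros R l. apply HM.
    - unfold N. apply Nat.lt_succ_r.
      pose proof (proj1 (list_max_le (map (fun p => length (db_consts p)) Q') _)
        (Nat.le_refl _)) as Hle.
      rewrite Forall_forall in Hle. apply Hle. now apply (in_map (fun p => length (db_consts p))). }
  assert (exists (A : structure Sig) (g : nat -> dom A),
    sat_db A g M /\ models A T /\ ~ sat_cq A q) as (A & g & HgM & HAT & HAq).
  { apply NNPP. intros Hn. apply HMent. intros A g H1 H2. apply NNPP. intros H3.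
    apply Hn. exists A, g. auto. }
  set (rep := fun i => epsilon (inhabits (root Sig 0)) (fun y => U y /\ f y = i)).
  (* Numbers that are no class of a node of [U] default to a root, so every element of the finite
     domain stands for a node of [U]. *)
  set (rep' := fun i => if excluded_middle_informative (U (rep i)) then rep i else root Sig 0).
  assert (forall i, U (rep' i)) as Hrep1.
  { intros i. unfold rep'. destruct excluded_middle_informative; auto.
    apply HU. now left. }
  assert (forall x, U x -> f (rep' (f x)) = f x) as Hrep2.
  { intros x Hx. unfold rep'.
    assert (U (rep (f x)) /\ f (rep (f x)) = f x) as [H1 H2].
    { unfold rep. apply epsilon_spec. now exists x. }
    now destruct excluded_middle_informative. }
  assert (forall R l, rel (forest ar D U) R l -> rel A R (map (fun x => g (f x)) l)) as HgU.
  { intros R l Hl. unfold sat_db in HgM. rewrite Forall_forall in HgM.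
    rewrite <- (map_map f g). apply (HgM (mkAtom R (map f l))). apply HM. now exists l. }
  set (gam := fun k : Fin.t B => g (f (rep' (Fin2Restrict.f2n k)))).
  set (cls := fun x => Fin2Restrict.n2f (Hf x)).
  assert (forall x, U x -> gam (cls x) = g (f x)) as Hgam.
  { intros x Hx. unfold gam, cls. rewrite Fin2Restrict.f2n_n2f. now rewrite Hrep2. }
  (* Relations are pulled back along [gam], so atoms transfer both ways; this settles datalog rules
     and the query at once. *)
  exists (mkStructure (Fin.t B) (fun R l => rel A R (map gam l))), (fun n => cls (root Sig n)).
  set (M' := mkStructure _ _).
  assert (forall v b, holds M' v b -> holds A (fun y => gam (v y)) b) as Hholds.
  { intros v [R l]. unfold holds. simpl. now rewrite map_map. }
  split; [|split; [|split]].
  - apply Fin_Finite.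
  - apply Forall_forall. intros [R a] Ha. unfold holds. simpl. rewrite map_map.
    rewrite (map_ext_in _ (fun n => g (f (root Sig n)))).
    + rewrite <- (map_map (@root Sig) (fun x => g (f x))). apply HgU. left. now exists a.
    + intros n Hn. apply Hgam. apply HU. right. eapply in_db_consts; eauto.
  - unfold wf_theory in HT. apply Forall_forall. intros rl Hrl.
    rewrite Forall_forall in HT. specialize (HT _ Hrl).
    pose proof (proj1 (Forall_forall _ _) HAT _ Hrl) as Hsat.
    destruct rl as [body Q ys|body Q ys]; simpl in *; intros v Hv.
    2:{ rewrite map_map. apply Hsat. revert Hv. apply Forall_impl. auto. }
    destruct (Hsat (fun y => gam (v y))) as [d Hd].
    { revert Hv. apply Forall_impl. auto. }
    destruct HT as (_ & Har' & _).
    (* With arity at most 2 the head has at most one argument besides the witness; it becomes the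
       parent [u], and a root serves if there is none. *)
    assert (exists u, U u /\ forall z,
      z :: map (fun y => gam (v y)) ys = child_args ar Q z (g (f u))) as (u & Hu & Hargs).
    { unfold child_args. rewrite <- Har'.
      destruct ys as [|y [|y' ys]]; simpl.
      - exists (root Sig 0). split; auto. apply HU. now left.
      - exists (rep' (Fin2Restrict.f2n (v y))). auto.
      - exfalso. specialize (Har Q). simpl in Har'. lia. }
    rewrite Hargs in Hd.
    destruct (classic (U (child Q u))) as [HQu|HQu].
    + exists (cls (child Q u)). rewrite map_map, Hargs, Hgam by auto.
      rewrite <- (map_child_args ar Q (fun x => g (f x))). apply HgU. right. now exists u.
    + exfalso. apply HAq.
      assert (In Q L) as HQL.
      { apply in_flat_map. exists (TGD body Q ys). split; auto. now left. }
      (* [B] is a fresh constant, as all values of [f] lie below it; it names the missing child of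
         the class of [u]. *)
      set (M2 := mkAtom Q (child_args ar Q B (f u)) :: M).
      assert (Forall (wf_atom ar) M2) as HM2.
      { constructor; auto. now apply length_child_args. }
      set (phi := fun x => if excluded_middle_informative (x = child Q u) then B else f x).
      assert (forall x, x <> child Q u -> phi x = f x) as Hphi.
      { intros x Hx. unfold phi. now destruct excluded_middle_informative. }
      assert (entails T M2 q) as HM2q.
      (* By maximality the forest with the added child satisfies [Q'], and [phi] maps this forest
         into [M2]. *)
      { apply HQ'; auto.
        refine (@sat_ucq_hom _ (forest ar D _) (db_structure M2) phi _ _ (Hfull Q u HQL Hu HQu)).
        intros R l Hl. simpl. destruct Hl as [(a & Ha & ->)|(x & [Hx|Hx] & ->)].
        - right. apply HM. exists (map (@root Sig) a). split; [left; now exists a|].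
          apply map_ext_in. intros y Hy. apply Hphi. intros ->.
          apply in_map_iff in Hy. destruct Hy as (n & E & _). discriminate E.
        - right. apply HM. exists (child_args ar R (child R x) x). split; [right; now exists x|].
          apply map_ext_in. intros y Hy. apply Hphi. intros ->.
          apply in_child_args in Hy. destruct Hy as [E|E]; apply HQu.
          + now rewrite E.
          + rewrite E. now apply HU in Hx.
        - left. destruct x as [d' w], u as [d'' w']. injection Hx as -> -> ->.
          rewrite map_child_args. rewrite (Hphi (d'', w')).
          2:{ intros E. apply (f_equal (fun x => length (snd x))) in E. simpl in E. lia. }
          unfold phi. now destruct excluded_middle_informative. }
      (* Sending [B] to the witness [d] makes [A] a model of [M2], so [A] would satisfy [q]. *)
      set (g' := fun i => if Nat.eq_dec i B then d else g i).
      assert (forall x, g' (f x) = g (f x)) as Hg'.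
      { intros x. pose proof (Hf x). unfold g'. destruct (Nat.eq_dec (f x) B); [lia|auto]. }
      apply (HM2q A g'); [|exact HAT].
      constructor.
      * unfold holds. simpl. rewrite map_child_args, Hg'. unfold g' at 1.
        now destruct (Nat.eq_dec B B).
      * apply Forall_forall. intros [R l] Hl. apply HM in Hl. destruct Hl as (l' & Hl' & ->).
        unfold holds. simpl. rewrite map_map.
        rewrite (map_ext _ (fun x => g (f x))) by exact Hg'. now apply HgU.
  - intros [v Hv]. apply HAq. exists (fun y => gam (v y)).
    revert Hv. apply Forall_impl. auto.
Qed.
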